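(* Let $T$ be a set of $n$ teams with strengths $s_i\in\mathbb{N}$ ($i\in T$), partitioned into two nonempty associations $R$ (red teams) and $B$ (blue teams), where teams from the same association are not allowed to play against each other, and let every team have to play $k=2$ matches. Let $G_c$, $k^r$ and $k^b$ be as defined in the context. There exists a fair draw (in which no two teams of the same association play each other) precisely when $k^r=k^b$ and each of the bipartite components of $G_c$ has a perfect matching.
   Context: A draw (for $k$ matches per team, $1\le k\le n-1$) is a set of $nk/2$ matches, i.e. unordered pairs of distinct teams, such that each team occurs in exactly $k$ matches and no match occurs more than once. The opponent set of a team is the set of the $k$ teams it plays against. The strength of an opponent set is the average strength of its teams. A draw is fair if the strengths of all $n$ opponent sets are equal. Let $\bar s=\frac1n\sum_{i\in T}s_i$. The opponent graph $G=(V,E)$ has $V=T$ and $E=\{\{i,j\}: i\neq j,\ \tfrac12(s_i+s_j)=\bar s\}$. It consists of a clique on the teams of strength $\bar s$ and of complete bipartite components, each between the teams of strength $\bar s-d$ and the teams of strength $\bar s+d$ for some $d>0$. The colored opponent graph $G_c$ is the subgraph of $G$ with vertex set $T$ and edge set $E_c=E\cap\{\{i,j\}: i,j\in R \text{ or } i,j\in B\}$. Thus in $G_c$ the clique of $G$ splits into a red clique and a blue clique, and each bipartite component of $G$ splits into red and blue complete bipartite graphs (the bipartite components of $G_c$). Let $k_0^r$ and $k_0^b$ denote the number of vertices in the red and the blue clique, respectively, and let $k^r_{\mathrm{bp}}$ and $k^b_{\mathrm{bp}}$ denote the number of red and blue vertices in the bipartite components of $G_c$, respectively. Put $k^r=k_0^r+k^r_{\mathrm{bp}}$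 and $k^b=k_0^b+k^b_{\mathrm{bp}}$. Without loss of generality, $k^r_{\mathrm{bp}}\ge k^b_{\mathrm{bp}}$.
   Formalization: A red or blue clique consisting of a single team also counts as a bipartite component (without a perfect matching); otherwise the claim fails, e.g. for red strengths 0,1,2 and blue strengths 0,1,2, where no fair draw exists. *)

(* Defs.v *)
(* MathComp: the teams form a finType, strengths are averaged in rat. *)
From HB Require Import structures.
From mathcomp Require Import all_boot all_order all_algebra.
Set Implicit Arguments.
Unset Strict Implicit.
Unset Printing Implicit Defensive.
Import Order.TTheory GRing.Theory Num.Theory.
Local Open Scope ring_scope.

Section Graphs.
Variables (T : finType) (e : rel T).

Definition components : {set {set T}} :=
  [set [set j | connect e i j] | i : T].

Definition bipartite_on (C : {set T}) : bool :=
  [exists X : {set T}, forall i in C, forall j in C,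
     e i j ==> ((i \in X) != (j \in X))].

(* An isolated vertex is a bipartite component (K_{1,0}); it has no perfect
   matching. *)
Definition bipartite_components : {set {set T}} :=
  [set C in components | bipartite_on C].

Definition perfect_matching (C : {set T}) (M : {set {set T}}) : Prop :=
  partition M C /\
  (forall m : {set T}, m \in M -> exists i j : T, e i j /\ m = [set i; j]).

End Graphs.

Section Draws.
Variables (T : finType) (s : T -> nat).

Definition avg_strength (X : {set T}) : rat :=
  (\sum_(i in X) (s i)%:R) / #|X|%:R.

Definition mean_strength : rat := avg_strength [set: T].

(* A match is a two-element set of teams, so a set of matches has no repeats;
   that there are nk/2 of them follows by double counting. *)
Definition is_draw (k : nat) (D : {set {set T}}) : Prop :=
  (forall m : {set T}, m \in D -> #|m| = 2) /\
  (forall i : T, #|[set m in D | i \in m]| = k).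

Definition opponents (D : {set {set T}}) (i : T) : {set T} :=
  [set j | (j != i) && ([set i; j] \in D)].

Definition fair (D : {set {set T}}) : Prop :=
  forall i j : T, avg_strength (opponents D i) = avg_strength (opponents D j).

Definition respects (R B : {set T}) (D : {set {set T}}) : Prop :=
  forall m : {set T}, m \in D -> ~~ (m \subset R) && ~~ (m \subset B).

Definition opponent_graph : rel T :=
  [rel i j | (i != j) && (((s i)%:R + (s j)%:R) / 2%:R == mean_strength)].

Definition colored_opponent_graph (R B : {set T}) : rel T :=
  [rel i j | opponent_graph i j &&
     (((i \in R) && (j \in R)) || ((i \in B) && (j \in B)))].

Definition clique (A : {set T}) : {set T} :=
  [set i in A | (s i)%:R == mean_strength].

Definition k_clique (A : {set T}) : nat := #|clique A|.

(* A clique with one or two vertices is itself a bipartite graph; its vertices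
   are removed here because k_clique already counts them. *)
Definition k_bipartite (R B A : {set T}) : nat :=
  #|[set i in A | i \in cover
       (bipartite_components (colored_opponent_graph R B))] :\: clique A|.

Definition k_color (R B A : {set T}) : nat :=
  (k_clique A + k_bipartite R B A)%N.

End Draws.

(* Main.v *)
Require Import Defs.
From mathcomp Require Import all_boot all_order all_algebra.
From mathcomp Require Import zify lra.
Import GRing.Theory Num.Theory.
Set Implicit Arguments.
Unset Strict Implicit.

(* In a fair draw the two opponents of every team form an edge of G_c.  Each
   side of the statement is equivalent to: |R| = |B|, and for each color and
   each d, as many teams deviate from the mean by d as by -d, while the clique
   of that color does not consist of a single team.  From a fair draw this
   follows by double counting.  Conversely, split off an edge of G_c in each
   color, again and again, and let the two red and the two blue teams play a
   4-cycle; if |R| = |B| is odd, three red and three blue teams of mean strength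
   are left, and they play a 6-cycle. *)

(** * Opposed pairs, balanced sets and schedules *)

Section Schedules.
Variables (T : finType) (v : T -> rat).
Implicit Types (A R B : {set T}) (d : rel T) (t : rat).

(** With [v] the deviation from the mean strength, these are the edges of the opponent graph. *)
Definition opposed : rel T := [rel i j | (i != j) && (v i + v j == 0)%R].

Definition level A t : {set T} := [set i in A | v i == t].

(** Numerical form, within one color, of the existence of perfect matchings. At [t = 0] the first
    clause is void; the second excludes a lone team of mean strength, which would be an isolated
    vertex. *)
Definition balanced A : Prop :=
  (forall t, #|level A t| = #|level A (- t)%R|) /\ #|level A 0%R| != 1.

(* [d i j] says that i and j play each other: each team plays exactly two
   teams, both of the other color and joined by an edge of the opponent graph. *)
Definition schedule R B d : Prop :=
  [/\ symmetric d,
      forall i j, d i j -> (i \in R) && (j \in B) || (i \in B) && (j \in R)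
    & forall i, i \in R :|: B ->
        exists j k, opposed j k /\ [set l | d i l] = [set j; k]].

Lemma opposed_sym : symmetric opposed.
Proof. by move=> i j; rewrite /opposed /= eq_sym addrC. Qed.

Lemma opposedN i j : opposed i j -> v j = (- v i)%R.
Proof. by case/andP=> _; rewrite addrC addr_eq0 => /eqP. Qed.

Lemma schedule_sym R B d : schedule R B d -> schedule B R d.
Proof.
case=> dC dRB dE; split=> // [i j /dRB|i]; first by rewrite orbC.
by rewrite setUC; apply: dE.
Qed.

(** * Double counting in a schedule *)

Section Necessity.
Variables (R B : {set T}) (d : rel T).
Hypotheses (RB0 : [disjoint R & B]) (dP : schedule R B d).

Lemma schedule_color i j : d i j -> j \in R -> i \in B.
Proof.
case: dP => _ dRB _ /dRB + jR; rewrite (disjointFr RB0 jR) andbF.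
by case/andP.
Qed.

Lemma schedule_degree i : i \in R :|: B -> \sum_j d i j = 2.
Proof.
case: dP => _ _ dE /dE[j [k [/andP[jk _] /setP Ni]]].
rewrite -big_mkcond sum1_card; transitivity #|[set j; k]|; last by rewrite cards2 jk.
by apply: eq_card => l; have := Ni l; rewrite inE.
Qed.

(** Both sides count the pairs of a team of [A] and one of its two opponents, all of which are
    blue. *)
Lemma schedule_double_count A : A \subset R ->
  (2 * #|A| = \sum_(i in B) \sum_(j in A) d i j)%N.
Proof.
move=> AR; have [dC _ _] := dP.
rewrite mulnC -sum_nat_const.
under eq_bigr => i iA.
  rewrite -(@schedule_degree i) ?inE ?(subsetP AR) //.
  over.
rewrite exchange_big /= [RHS]big_mkcond /=; apply: eq_bigr => i _.
case: ifP => iB; first by apply: eq_bigr => j _; rewrite dC.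
apply: big1 => j jA; case dji: (d j i) => //.
by rewrite dC in dji; rewrite (schedule_color dji) ?(subsetP AR) in iB.
Qed.

(** The two opponents of a blue team have opposite values, so each blue team meets as many red teams
    of value [t] as of value [-t]. A red team of value 0 shares a blue opponent with a second red
    team of value 0. *)
Lemma schedule_balanced : balanced R.
Proof.
have [dC dRB dE] := dP.
have lR t : level R t \subset R by apply/subsetP => i; rewrite inE => /andP[].
split=> [t|].
  apply/eqP; rewrite -(eqn_pmul2l (isT : 0 < 2)%N).
  rewrite !schedule_double_count //; apply/eqP; apply: eq_bigr => i iB.
  have /dE[j [k [jk Ni]]] : i \in R :|: B by rewrite inE iB orbT.
  have sumE t' : (\sum_(l in level R t') d i l = (v j == t') + (v k == t'))%N.
    have [jk_neq _] := andP jk.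
    transitivity (\sum_(l in [set j; k]) (v l == t'))%N; last first.
      by rewrite big_setU1 ?big_set1 ?inE.
    rewrite -Ni [LHS]big_mkcond [RHS]big_mkcond /=; apply: eq_bigr => l _.
    rewrite !inE; case dil: (d i l); last by case: ifP.
    suff -> : l \in R by case: eqP.
    by have /dRB := dil; rewrite iB (disjointFl RB0 iB).
  by rewrite !sumE (opposedN jk) eqr_opp [RHS]addnC eqr_oppLR.
apply/cards1P => -[i /setP lE].
have := lE i; rewrite !inE eqxx => /andP[iR /eqP vi0].
have /dE[j [? [_ Ni]]] : i \in R :|: B by rewrite inE iR.
have dij : d i j by have /setP/(_ j) := Ni; rewrite !inE eqxx.
have jB : j \in B by move/dRB: dij; rewrite iR (disjointFr RB0 iR) orbF.
have /dE[k [l [kl /setP Nj]]] : j \in R :|: B by rewrite inE jB orbT.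
(* The opponents [k] and [l] of [j] are interchangeable and [i] is one of them; the other is the
   second red team of value 0. *)
wlog ik : k l kl Nj / i = k.
  move=> W; have := Nj i; rewrite !inE dC dij => /esym/orP[/eqP ik|/eqP il].
    exact: W kl Nj ik.
  by apply: (W l k) => [|x|//]; rewrite 1?opposed_sym // Nj !inE orbC.
have lR' : l \in R.
  have /dRB : d j l by have := Nj l; rewrite !inE eqxx orbT.
  by rewrite jB (disjointFl RB0 jB).
have := lE l; rewrite !inE lR' (opposedN kl) -ik vi0 oppr0 eqxx.
by move/esym/eqP => li; case/andP: kl; rewrite -ik li eqxx.
Qed.

Lemma schedule_card : #|R| = #|B|.
Proof.
apply/eqP; rewrite -(eqn_pmul2l (isT : 0 < 2)%N) schedule_double_count //.
rewrite mulnC -sum_nat_const; apply/eqP; apply: eq_bigr => i iB.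
rewrite -(@schedule_degree i) ?inE ?iB ?orbT // big_mkcond.
apply: eq_bigr => j _; case: ifP => // jR; case dij: (d i j) => //.
by have [_ /(_ _ _ dij)] := dP; rewrite jR iB (disjointFl RB0 iB).
Qed.

End Necessity.

(** * Splitting opposed pairs off a balanced set *)

Lemma card_levelD2 A i j t : i \in A -> j \in A -> i != j ->
  #|level A t| = ((v i == t) + (v j == t) + #|level (A :\ i :\ j) t|)%N.
Proof.
move=> iA jA ij; rewrite (cardsD1 i) (cardsD1 j (_ :\ i)) !inE iA jA addnA.
rewrite (eq_sym j i) ij /=; congr (_ + _)%N; apply: eq_card => k.
by rewrite !inE -!andbA.
Qed.

Lemma cardsD2 A i j : i \in A -> j \in A -> i != j ->
  #|A| = #|A :\ i :\ j|.+2.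
Proof.
by move=> iA jA ij; rewrite (cardsD1 i) (cardsD1 j (_ :\ i)) !inE iA jA (eq_sym j i) ij.
Qed.

(** The removed teams contribute [(v i == t) + (v j == t)], which is the same at [t] and at [-t] and
    cancels; only the level of 0 needs a hypothesis. *)
Lemma balancedD2 A i j : balanced A -> i \in A -> j \in A -> opposed i j ->
  #|level (A :\ i :\ j) 0%R| != 1 -> balanced (A :\ i :\ j).
Proof.
move=> [Ab _] iA jA ij ij1; split=> // t; have [ij' _] := andP ij.
have := Ab t; rewrite !(card_levelD2 _ iA jA) // (opposedN ij).
by rewrite eqr_opp eqr_oppLR (addnC (v i == t)) => /addnI.
Qed.

(** Balance puts some [j] at the value [- v i]; it differs from [i] as [v i] is nonzero, and
    removing both leaves the level of 0 untouched. *)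
Lemma balanced_split_nonzero A i : balanced A -> i \in A -> v i != 0%R ->
  exists j, [/\ j \in A, opposed i j & balanced (A :\ i :\ j)].
Proof.
move=> Ab iA vi0; have [AN A1] := Ab.
have : 0 < #|level A (- v i)%R|.
  by rewrite -AN; apply/card_gt0P; exists i; rewrite inE iA eqxx.
case/card_gt0P => j; rewrite inE => /andP[jA /eqP vj].
have ij : opposed i j.
  rewrite /opposed /= vj subrr eqxx andbT; apply: contraNneq vi0 => ij.
  by move: vj; rewrite -ij => /eqP; rewrite -addr_eq0 -mulr2n mulrn_eq0.
exists j; split=> //; apply: balancedD2 => //.
move: A1; rewrite (card_levelD2 _ iA jA) //; last by case/andP: ij.
by rewrite vj oppr_eq0 (negPf vi0).
Qed.

Lemma balanced_zero A : balanced A -> {in A, forall i, v i = 0%R} ->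
  #|A| != 1.
Proof.
case=> _ A1 A0; apply: contra A1 => /eqP <-; apply/eqP/eq_card => i.
by rewrite inE; case iA: (i \in A); rewrite //= A0.
Qed.

Lemma balanced_card1 A : balanced A -> #|A| != 1.
Proof.
move=> Ab; have [/existsP[i /andP[iA vi0]]|/existsPn A0] :=
    boolP [exists i, (i \in A) && (v i != 0%R)].
  have [j [jA /andP[ij _] _]] := balanced_split_nonzero Ab iA vi0.
  by rewrite (cardsD2 iA jA).
apply: balanced_zero => // i iA.
by apply/eqP; move: (A0 i); rewrite iA negbK.
Qed.

(** A nonzero value would allow an opposed pair to be split off, leaving a balanced set with one
    element. *)
Lemma balanced_card3 A : balanced A -> #|A| = 3 ->
  {in A, forall i, v i = 0%R}.
Proof.
move=> Ab A3 i iA; apply/eqP/negPn/negP => vi0.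
have [j [jA /andP[ij _] Ab']] := balanced_split_nonzero Ab iA vi0.
by move/balanced_card1: Ab'; move: A3; rewrite (cardsD2 iA jA) // => -[->].
Qed.

(** If all values are 0, any two elements are opposed, and the rest is balanced unless it is a
    single team; this is why three elements are excluded. *)
Lemma balanced_split A : balanced A -> A != set0 -> #|A| != 3 ->
  exists i j, [/\ i \in A, j \in A, opposed i j & balanced (A :\ i :\ j)].
Proof.
move=> Ab A_neq0 A3; have [/existsP[i /andP[iA vi0]]|/existsPn A0] :=
    boolP [exists i, (i \in A) && (v i != 0%R)].
  by have [j []] := balanced_split_nonzero Ab iA vi0; exists i, j.
have {}A0 i : i \in A -> v i = 0%R.
  by move=> iA; apply/eqP; move: (A0 i); rewrite iA negbK.
have /card_gt1P[i [j [iA jA ij]]] : 1 < #|A|.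
  by have := balanced_card1 Ab; move: A_neq0; rewrite -card_gt0; case: #|A| => [|[]].
have ij_opp : opposed i j by rewrite /opposed /= ij !A0 ?addr0.
exists i, j; split=> //; apply: balancedD2 => //.
rewrite (_ : level _ _ = A :\ i :\ j).
  by move: A3; rewrite (cardsD2 iA jA).
apply/setP => k; rewrite !inE; case: (boolP (k \in A)) => [/A0 ->|_].
  by rewrite eqxx !andbT.
by rewrite !andbF.
Qed.

(** * Building schedules from 4-cycles and a 6-cycle *)

Lemma opposed_of_zero i j : v i = 0%R -> v j = 0%R -> i != j -> opposed i j.
Proof. by move=> vi vj ij; rewrite /opposed /= ij vi vj addr0 eqxx. Qed.

(* The hexagon: K_{3,3} without a perfect matching. *)
Lemma schedule3 R B : [disjoint R & B] -> #|R| = 3 -> #|B| = 3 ->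
  {in R, forall i, v i = 0%R} -> {in B, forall i, v i = 0%R} ->
  exists d, schedule R B d.
Proof.
move=> RB R3 B3 R0 B0.
have triple A : #|A| = 3 -> exists x y z,
    [/\ x != y, y != z, z != x & A =i [:: x; y; z]].
  move=> A3; have /card_gt2P[x [y [z [[xA yA zA] [xy yz zx]]]]] : 2 < #|A|.
    by rewrite A3.
  exists x, y, z; split=> // i.
  suff -> : A = [set x; y; z] by rewrite !inE orbA.
  apply/eqP; rewrite eq_sym eqEcard A3 !subUset !sub1set xA yA zA /=.
  by rewrite setUC cardsU1 cards2 !inE xy negb_or zx eq_sym yz.
have [x [y [z [xy yz zx RE]]]] := triple _ R3.
have [x' [y' [z' [xy' yz' zx' BE]]]] := triple _ B3.
have neq i j : i \in R -> j \in B -> i == j = false.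
  by move=> iR jB; apply: contraTF iR => /eqP ->; rewrite (disjointFl RB jB).
(* The omitted pairs are [(x, x')], [(y, y')] and [(z, z')]. *)
set s := [:: (x, y'); (x, z'); (y, x'); (y, z'); (z, x'); (z, y')].
exists [rel i j | ((i, j) \in s) || ((j, i) \in s)].
have [xR yR zR] : [/\ x \in R, y \in R & z \in R] by rewrite !RE !inE !eqxx !orbT.
have [xB yB zB] : [/\ x' \in B, y' \in B & z' \in B].
  by rewrite !BE !inE !eqxx !orbT.
have {}xy := negPf xy; have {}yz := negPf yz; have {}zx := negPf zx.
have {}xy' := negPf xy'; have {}yz' := negPf yz'; have {}zx' := negPf zx'.
have neq' i j : j \in R -> i \in B -> i == j = false.
  by move=> jR iB; rewrite eq_sym neq.
have E := (neq x _ xR xB, neq x _ xR yB, neq x _ xR zB, neq y _ yR xB,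
  neq y _ yR yB, neq y _ yR zB, neq z _ zR xB, neq z _ zR yB, neq z _ zR zB).
have E' := (neq' _ x xR xB, neq' _ x xR yB, neq' _ x xR zB, neq' _ y yR xB,
  neq' _ y yR yB, neq' _ y yR zB, neq' _ z zR xB, neq' _ z zR yB, neq' _ z zR zB).
split=> [i j|i j|i].
- by rewrite /= orbC.
- have sRB k l : (k, l) \in s -> (k \in R) && (l \in B).
    rewrite /s !inE !xpair_eqE.
    by do 5?[case/orP]; case/andP => /eqP-> /eqP->; apply/andP.
  by case/orP => /sRB; [move=> -> | rewrite andbC => ->; rewrite orbT].
- have eqs := (xy, yz, zx, eq_sym y x, eq_sym z y, eq_sym x z,
    xy', yz', zx', eq_sym y' x', eq_sym z' y', eq_sym x' z').
  have opp k l : v k = 0%R -> v l = 0%R -> k == l = false -> opposed k l.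
    by move=> ? ? kl; apply: opposed_of_zero; rewrite ?kl.
  rewrite inE => /orP[]; rewrite ?RE ?BE !inE => /or3P[] /eqP ->.
  + exists y', z'; split; first by rewrite opp ?B0 ?eqs.
    by apply/setP => l; rewrite inE /= /s !inE !xpair_eqE !eqxx ?eqs ?E ?andbF ?orbF.
  + exists x', z'; split; first by rewrite opp ?B0 ?eqs.
    by apply/setP => l; rewrite inE /= /s !inE !xpair_eqE !eqxx ?eqs ?E ?andbF ?orbF.
  + exists x', y'; split; first by rewrite opp ?B0 ?eqs.
    by apply/setP => l; rewrite inE /= /s !inE !xpair_eqE !eqxx ?eqs ?E ?andbF ?orbF.
  + exists y, z; split; first by rewrite opp ?R0 ?eqs.
    by apply/setP => l; rewrite inE /= /s !inE !xpair_eqE !eqxx ?eqs ?E' ?andbF ?andbT ?orbF.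
  + exists x, z; split; first by rewrite opp ?R0 ?eqs.
    by apply/setP => l; rewrite inE /= /s !inE !xpair_eqE !eqxx ?eqs ?E' ?andbF ?andbT ?orbF.
  + exists x, y; split; first by rewrite opp ?R0 ?eqs.
    by apply/setP => l; rewrite inE /= /s !inE !xpair_eqE !eqxx ?eqs ?E' ?andbF ?andbT ?orbF.
Qed.

(* A 4-cycle through two opposed pairs extends a schedule of the other teams. *)
Lemma scheduleU R B d i j k l : [disjoint R & B] ->
  i \in R -> j \in R -> k \in B -> l \in B -> opposed i j -> opposed k l ->
  schedule (R :\ i :\ j) (B :\ k :\ l) d -> exists d', schedule R B d'.
Proof.
move=> RB iR jR kB lB ij kl [dC dRB dE].
pose P := [set i; j]; pose Q := [set k; l].
have PR m : m \in P -> m \in R by rewrite !inE => /orP[]/eqP->.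
have QB m : m \in Q -> m \in B by rewrite !inE => /orP[]/eqP->.
have RP m : m \in R :\ i :\ j -> (m \in R) && (m \notin P).
  by rewrite !inE negb_or => /and3P[-> -> ->].
have BQ m : m \in B :\ k :\ l -> (m \in B) && (m \notin Q).
  by rewrite !inE negb_or => /and3P[-> -> ->].
have RQ m : m \in R -> m \in Q = false.
  by move=> mR; apply: contraTF mR => /QB mB; rewrite (disjointFl RB mB).
have BP m : m \in B -> m \in P = false.
  by move=> mB; apply: contraTF mB => /PR mR; rewrite (disjointFr RB mR).
(* The old schedule does not touch the four new teams, so their only opponents come from the
   4-cycle. *)
have dPQ m n : d m n -> (m \notin P) && (m \notin Q).
  by move=> /dRB/orP[]/andP[]; [case/RP/andP=> /RQ-> -> | case/BQ/andP=> /BP-> ->].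
exists [rel m n | [|| d m n, (m \in P) && (n \in Q) | (m \in Q) && (n \in P)]].
split=> [m n|m n|m].
- by rewrite /= dC [_ && _ || _]orbC ![(n \in _) && _]andbC.
- case/or3P => [/dRB/orP[]/andP[]|/andP[/PR-> /QB->]//|/andP[/QB-> /PR->]].
  + by move=> /RP/andP[-> _] /BQ/andP[-> _].
  + by move=> /BQ/andP[-> _] /RP/andP[-> _]; rewrite orbT.
  + by rewrite orbT.
have [mP _|mP] := boolP (m \in P).
  exists k, l; split=> //; apply/setP => n; rewrite inE /= mP (RQ _ (PR _ mP)) orbF.
  by case dmn: (d m n) => //; have := dPQ _ _ dmn; rewrite mP.
have [mQ _|mQ] := boolP (m \in Q).
  exists i, j; split=> //; apply/setP => n; rewrite inE /= mQ (negPf mP).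
  by case dmn: (d m n) => //; have := dPQ _ _ dmn; rewrite mQ andbF.
move=> mRB; have /dE[a [b [ab Nm]]] : m \in (R :\ i :\ j) :|: (B :\ k :\ l).
  move: mRB mP mQ; rewrite !inE !negb_or.
  by move=> /orP[]-> /andP[-> ->] /andP[-> ->]; rewrite ?orbT.
exists a, b; split=> //; rewrite -Nm; apply/setP => n.
by rewrite !inE /= (negPf mP) (negPf mQ) orbF.
Qed.

(** Induction on the common size: opposed pairs leave both colors together, so the sizes stay equal.
    The induction ends at the empty set or at three teams of each color, which then all have value
    0. *)
Lemma balanced_schedule R B : [disjoint R & B] -> #|R| = #|B| ->
  balanced R -> balanced B -> exists d, schedule R B d.
Proof.
have [n] := ubnP #|R|; elim: n R B => // n IH R B Rn RB card_eq Rb Bb.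
have [R3|R3] := eqVneq #|R| 3.
  by apply: schedule3; rewrite -?card_eq //; apply: balanced_card3; rewrite -?card_eq.
have [R0|R0] := eqVneq R set0.
  have B0 : B = set0 by apply: cards0_eq; rewrite -card_eq R0 cards0.
  by exists [rel _ _ | false]; split=> // i; rewrite R0 B0 !inE.
have B0 : B != set0 by rewrite -card_gt0 -card_eq card_gt0.
have [i [j [iR jR ij Rb']]] := balanced_split Rb R0 R3.
have [|k [l [kB lB kl Bb']]] := balanced_split Bb B0; first by rewrite -card_eq.
have [ij' _] := andP ij; have [kl' _] := andP kl.
have R2 := cardsD2 iR jR ij'; have B2 := cardsD2 kB lB kl'.
have [|||d dP] := IH (R :\ i :\ j) (B :\ k :\ l) _ _ _ Rb' Bb'; try lia.
  apply: disjointWl (disjointWr _ RB); exact: subset_trans (subD1set _ _) (subD1set _ _).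
exact: scheduleU dP.
Qed.
End Schedules.

(** * Perfect matchings of complete bipartite graphs *)

Section PerfectMatchings.
Variables (T : finType) (e : rel T).
Hypothesis eC : symmetric e.
Implicit Types (C X Y : {set T}) (M : {set {set T}}).

Lemma perfect_matching_partner C M i : perfect_matching e C M -> i \in C ->
  exists j, e i j /\ [set i; j] \in M.
Proof.
case=> /and3P[/eqP <- _ _] Me /bigcupP[m mM im].
have [j [k [jk mE]]] := Me m mM.
move: im mM; rewrite mE !inE => /orP[]/eqP ->; first by exists k.
by exists j; rewrite eC setUC.
Qed.

(** Any edge can be matched first: what remains is again complete bipartite with sides of equal
    size. *)
Lemma perfect_matching_biclique X Y : [disjoint X & Y] -> #|X| = #|Y| ->
  {in X & Y, forall i j, e i j} -> exists M, perfect_matching e (X :|: Y) M.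
Proof.
have [n] := ubnP #|X|; elim: n X Y => // n IH X Y Xn XY card_eq eXY.
have [X0|[i iX]] := set_0Vmem X.
  have Y0 : Y = set0 by apply: cards0_eq; rewrite -card_eq X0 cards0.
  exists set0; split=> [|m]; last by rewrite inE.
  by rewrite X0 Y0 setU0 partition_set0.
have [j jY] : exists j, j \in Y.
  by apply/card_gt0P; rewrite -card_eq; apply/card_gt0P; exists i.
have [|||k l|M [MP Me]] := IH (X :\ i) (Y :\ j).
- by move: Xn; rewrite (cardsD1 i) iX.
- exact: disjointW (subD1set X i) (subD1set Y j) XY.
- by move: card_eq; rewrite (cardsD1 i) (cardsD1 j Y) iX jY => -[].
- by rewrite !inE => /andP[_ kX] /andP[_ lY]; apply: eXY.
have iY : i \in Y = false by rewrite (disjointFr XY iX).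
have jX : j \in X = false by rewrite (disjointFl XY jY).
exists ([set i; j] |: M); split.
  have -> : X :|: Y = [set i; j] :|: (X :\ i :|: Y :\ j).
    apply/setP => k; rewrite !inE.
    have [->|_] := eqVneq k i; first by rewrite iX.
    by have [->|_] := eqVneq k j; rewrite ?jY ?orbT.
  apply: partitionU1 => //; first by apply/set0Pn; exists i; rewrite !inE eqxx.
  rewrite disjoints_subset; apply/subsetP => k; rewrite !inE.
  by case/orP => /eqP->; rewrite eqxx ?iY ?jX ?andbF.
move=> m; rewrite inE => /orP[/set1P->|/Me //].
by exists i, j; split=> //; apply: eXY.
Qed.

End PerfectMatchings.

(** * Components of the colored opponent graph *)

Section ColoredOpponentGraph.
Variables (T : finType) (s : T -> nat) (R B : {set T}).
Hypotheses (RB : [disjoint R & B]) (RBT : R :|: B = setT).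

Definition deviation (i : T) : rat := ((s i)%:R - mean_strength s)%R.

Notation v := deviation.
Notation e := (colored_opponent_graph s R B).

Lemma opponent_graphE i j : opponent_graph s i j = opposed v i j.
Proof.
rewrite /opponent_graph /opposed /= /deviation; congr (_ && _).
by apply/eqP/eqP => h; lra.
Qed.

Lemma in_blue i : (i \in B) = (i \notin R).
Proof.
have : i \in R :|: B by rewrite RBT inE.
rewrite inE; case: (boolP (i \in R)) => [iR _|_ /= ->//].
by rewrite (disjointFr RB iR).
Qed.

Lemma colored_opponent_graphE i j :
  e i j = opposed v i j && ((i \in R) == (j \in R)).
Proof.
have -> : e i j = opponent_graph s i j &&
    ((i \in R) && (j \in R) || (i \in B) && (j \in B)) by [].
by rewrite opponent_graphE !in_blue; case: (i \in R); case: (j \in R).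
Qed.

Lemma colored_opponent_graph_sym : symmetric e.
Proof.
by move=> i j; rewrite !colored_opponent_graphE opposed_sym [_ == (j \in R)]eq_sym.
Qed.

(** An edge keeps the color and negates the deviation, so the predicate [a] is closed under [e]. *)
Lemma connect_deviation i j : connect e i j ->
  (j \in R) = (i \in R) /\ (v j = v i \/ v j = (- v i)%R).
Proof.
pose a := [pred j | ((j \in R) == (i \in R)) &&
                    ((v j == v i) || (v j == - v i)%R)].
have aP : closed e a.
  move=> k l; rewrite colored_opponent_graphE => /andP[/opposedN kl /eqP c].
  by rewrite !inE c kl (eqr_opp (v k)) (eqr_oppLR (v k)) [in RHS]orbC.
move/(closed_connect aP); rewrite !inE !eqxx => /esym/andP[/eqP-> /orP[]/eqP->].
  by split=> //; left.
by split=> //; right.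
Qed.

(** Edges alternate between the deviations [v i] and [- v i], which are distinct; the former is one
    side of the bipartition. *)
Lemma bipartite_component i : v i != 0%R ->
  [set j | connect e i j] \in bipartite_components e.
Proof.
move=> vi0; rewrite inE imset_f //=.
apply/existsP; exists [set j | v j == v i].
apply/forall_inP => k; rewrite inE => /connect_deviation[_ vk].
apply/forall_inP => l _; apply/implyP; rewrite colored_opponent_graphE.
case/andP => /opposedN kl _; rewrite !inE kl.
have viN : (v i == - v i)%R = false.
  by apply: contra_neqF vi0 => /eqP; lra.
by case: vk => ->; rewrite ?opprK ?eqxx ![(- v i == _)%R]eq_sym viN.
Qed.

(** A team outside the clique has nonzero deviation, hence lies in a bipartite component. The
    condition on [k_color] thus becomes equality of the sizes of [R] and [B]. *)
Lemma k_colorE A : k_color s R B A = #|A|.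
Proof.
rewrite /k_color /k_clique -(cardsID (clique s A) A).
have /setIidPr -> : clique s A \subset A.
  by apply/subsetP => i; rewrite inE => /andP[].
congr (_ + _)%N; apply: eq_card => i; rewrite !inE.
case iA: (i \in A); rewrite //=; case: eqP => //= vi.
apply/bigcupP; exists [set j | connect e i j]; last by rewrite inE connect0.
by apply: bipartite_component; rewrite subr_eq0; apply/eqP.
Qed.

(** * Perfect matchings and balance within one color *)

Section Color.
Variable A : {set T}.
Hypothesis AC : A = R \/ A = B.

Lemma color_mem i j : i \in A -> (j \in A) = ((i \in R) == (j \in R)).
Proof.
by case: AC => ->; rewrite ?in_blue; case: (i \in R); case: (j \in R).
Qed.

Lemma color_edge i j : i \in A -> e i j = opposed v i j && (j \in A).
Proof. by move=> iA; rewrite colored_opponent_graphE (color_mem j iA). Qed.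

Lemma level_opposed i j : v i != 0%R -> v i = (- v j)%R ->
  opposed v i j.
Proof.
move=> vi0 ij; rewrite /opposed /= ij addNr eqxx andbT.
by apply: contraNneq vi0 => ij'; apply/eqP; move: ij; rewrite ij'; lra.
Qed.

(** For nonzero [t], a perfect matching maps the level of [t] injectively into that of [-t]. *)
Lemma matched_level_leq t :
  (forall C, C \in bipartite_components e ->
     exists M, perfect_matching e C M) ->
  #|level v A t| <= #|level v A (- t)%R|.
Proof.
move=> HM; have [->|t0] := eqVneq t 0%R; first by rewrite oppr0.
have [->|[i0]] := set_0Vmem (level v A t); first by rewrite cards0.
rewrite inE => /andP[i0A /eqP vi0].
have [|M MP] := HM [set j | connect e i0 j].
  by apply: bipartite_component; rewrite vi0.
have partner i := perfect_matching_partner colored_opponent_graph_sym (i := i) MP.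
have [|j0 [ij0 _]] := partner i0; first by rewrite inE connect0.
(* The partner [j0] of [i0] is adjacent to the whole level, so all of it lies in one component and
   one matching [M] serves every [i]. *)
have {}partner i : i \in level v A t -> exists j, e i j && ([set i; j] \in M).
  rewrite inE => /andP[iA /eqP vi].
  have [|j [ij jM]] := partner i; last by exists j; rewrite ij.
  rewrite inE; apply: connect_trans (connect1 ij0) (connect1 _).
  move: ij0; rewrite [e j0 i]colored_opponent_graph_sym !color_edge //.
  move=> /andP[/opposedN vj0 ->]; rewrite andbT.
  by rewrite opposed_sym level_opposed ?vj0 ?vi ?vi0 // oppr_eq0.
pose f i := odflt i [pick j | e i j && ([set i; j] \in M)].
have fP i : i \in level v A t -> e i (f i) /\ [set i; f i] \in M.
  move=> /partner[j ij]; rewrite /f; case: pickP => [k /andP[]//|/(_ j)].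
  by rewrite ij.
rewrite -(@card_in_imset _ _ f) => [|i j /fP[ei iM] /fP[ej jM] fij].
  apply/subset_leq_card/subsetP => _ /imsetP[i it ->].
  have [ei _] := fP i it; move: it ei; rewrite !inE => /andP[iA /eqP<-].
  by rewrite color_edge // => /andP[/opposedN-> ->]; rewrite eqxx.
have [/and3P[_ tM _] _] := MP.
(* The blocks of [i] and [j] share [f i = f j], so they coincide. *)
have : i \in [set j; f j].
  rewrite -(def_pblock tM jM (_ : f i \in _)) ?fij ?inE ?eqxx ?orbT //.
  by rewrite -fij (def_pblock tM iM) !inE ?eqxx ?orbT.
rewrite !inE => /orP[/eqP//|/eqP ifj].
by move: ei; rewrite fij -ifj colored_opponent_graphE /opposed /= eqxx.
Qed.

(** The inequality is applied to [t] and to [-t]. A lone team of mean strength would be an isolated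
    vertex, that is, a bipartite component without a perfect matching. *)
Lemma matched_balanced :
  (forall C, C \in bipartite_components e ->
     exists M, perfect_matching e C M) -> balanced v A.
Proof.
move=> HM; split=> [t|].
  apply/eqP; rewrite eqn_leq matched_level_leq //=.
  by rewrite -{2}[t]opprK matched_level_leq.
apply/cards1P => -[i /setP lE].
have := lE i; rewrite !inE eqxx => /andP[iA /eqP vi0].
have iC j : connect e i j -> j = i.
  case/connect_deviation => jR; rewrite vi0 oppr0 => vj.
  apply/set1P; rewrite -lE inE (color_mem j iA) jR eqxx.
  by case: vj => ->; rewrite eqxx.
have [|M MP] := HM [set j | connect e i j].
  rewrite inE imset_f //=; apply/existsP; exists set0.
  apply/forall_inP => k; rewrite inE => /iC->.
  apply/forall_inP => l; rewrite inE => /iC->.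
  by rewrite colored_opponent_graphE /opposed /= eqxx.
have [|j [ij _]] := perfect_matching_partner colored_opponent_graph_sym (i := i) MP.
  by rewrite inE connect0.
have ji := iC j (connect1 ij).
by move: ij; rewrite ji colored_opponent_graphE /opposed /= eqxx.
Qed.

(** If [v i = 0], the component is a clique; being bipartite and not a single vertex, it is one
    edge. Otherwise it is the complete bipartite graph between the levels of [v i] and [- v i],
    which have equal size. *)
Lemma balanced_matched i : balanced v A -> i \in A ->
  [set j | connect e i j] \in bipartite_components e ->
  exists M, perfect_matching e [set j | connect e i j] M.
Proof.
set C := [set j | _] => -[AN A1] iA; rewrite inE => /andP[_ /existsP[X XP]].
have CP j : j \in C -> j \in A /\ (v j = v i \/ v j = (- v i)%R).
  by rewrite inE (color_mem j iA) => /connect_deviation[->]; rewrite eqxx.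
have [vi0|vi0] := eqVneq (v i) 0%R.
  (* Any two vertices of the clique are adjacent, so [X] separates them. *)
  have XC j k : j \in C -> k \in C -> j != k -> (j \in X) != (k \in X).
    move=> jC kC jk; have /forall_inP/(_ j jC)/forall_inP/(_ k kC) := XP.
    have [[jA vj] [kA vk]] := (CP j jC, CP k kC).
    rewrite color_edge // kA andbT => /implyP; apply.
    move: vj vk; rewrite vi0 oppr0 => vj vk.
    by apply: opposed_of_zero => //; [case: vj | case: vk].
  have C_le1 (Y : {set T}) : Y \subset C ->
      {in Y &, forall j k, (j \in X) = (k \in X)} -> #|Y| <= 1.
    move=> YC YX; rewrite leqNgt; apply/card_gt1P => -[j [k [jY kY jk]]].
    by have := XC j k (subsetP YC _ jY) (subsetP YC _ kY) jk; rewrite (YX j k) ?eqxx.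
  have C_gt1 : 1 < #|C|.
    have -> : C = level v A 0%R.
      apply/setP => j; apply/idP/idP => [/CP[jA vj]|].
        by rewrite inE jA; move: vj; rewrite vi0 oppr0 => -[]->; rewrite eqxx.
      rewrite !inE => /andP[jA /eqP vj]; have [->|ij] := eqVneq i j.
        exact: connect0.
      by apply: connect1; rewrite color_edge // jA opposed_of_zero.
    suff : 0 < #|level v A 0%R| by move: A1; case: #|_| => [|[]].
    by apply/card_gt0P; exists i; rewrite inE iA vi0 eqxx.
  have C1 : #|C :&: X| <= 1.
    apply: C_le1 (subsetIl _ _) _ => j k.
    by rewrite !inE => /andP[_ ->] /andP[_ ->].
  have C2 : #|C :\: X| <= 1.
    apply: C_le1 (subsetDl _ _) _ => j k.
    by rewrite !inE => /andP[/negPf-> _] /andP[/negPf-> _].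
  rewrite -(setID C X); apply: perfect_matching_biclique.
  - by rewrite -setI_eq0 setIC setDE -setIA [~: X :&: _]setIC -setIA setICr !setI0.
  - by move: C_gt1 C1 C2; rewrite -(cardsID X C); lia.
  move=> j k; rewrite !inE => /andP[jC jX] /andP[kX kC].
  have [[jA vj] [kA vk]] : (j \in A /\ (v j = v i \/ v j = (- v i)%R)) /\
      (k \in A /\ (v k = v i \/ v k = (- v i)%R)) by split; apply: CP; rewrite inE.
  move: vj vk; rewrite vi0 oppr0 => vj vk.
  rewrite color_edge // kA andbT.
  apply: opposed_of_zero; [by case: vj|by case: vk|].
  by apply: contraNneq kX => <-.
have -> : C = level v A (v i) :|: level v A (- v i)%R.
  apply/setP => j; rewrite in_setU; apply/idP/idP => [/CP[jA vj]|].
    by rewrite !inE jA; case: vj => ->; rewrite eqxx ?orbT.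
  have eN k : k \in level v A (- v i)%R -> e i k.
    rewrite inE => /andP[kA /eqP vk]; rewrite color_edge // kA andbT.
    by apply: level_opposed; rewrite // vk opprK.
  (* A team of the same value as [i] is reached through a team of the opposite value, which exists
     by balance. *)
  case/orP => [|/eN ij]; last by rewrite inE connect1.
  have : 0 < #|level v A (- v i)%R|.
    by rewrite -AN; apply/card_gt0P; exists i; rewrite inE iA eqxx.
  case/card_gt0P => k kN; rewrite !inE => /andP[jA /eqP vj].
  apply: connect_trans (connect1 (eN k kN)) (connect1 _).
  rewrite colored_opponent_graph_sym color_edge //.
  move: kN; rewrite inE => /andP[-> /eqP vk]; rewrite andbT.
  by apply: level_opposed; rewrite ?vk ?opprK ?vj.
apply: perfect_matching_biclique; last 1 first.
- move=> j k; rewrite !inE => /andP[jA /eqP vj] /andP[kA /eqP vk].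
  rewrite color_edge // kA andbT.
  by apply: level_opposed; rewrite ?vk ?opprK ?vj.
- rewrite disjoints_subset; apply/subsetP => j; rewrite !inE => /andP[-> /eqP->] /=.
  by apply: contraNneq vi0; lra.
- exact: AN.
Qed.

End Color.
End ColoredOpponentGraph.

(** * Fair draws and schedules *)

Section Draws.
Variables (T : finType) (s : T -> nat) (R B : {set T}).
Hypotheses (RB : [disjoint R & B]) (RBT : R :|: B = setT).
Implicit Type D : {set {set T}}.
Notation v := (deviation s).

(** Pairing [j] with the match [[set i; j]] is a bijection from the opponents of [i] to its
    matches. *)
Lemma card_opponents D i : (forall m, m \in D -> #|m| = 2) ->
  #|opponents D i| = #|[set m in D | i \in m]|.
Proof.
move=> D2; rewrite -(@card_in_imset _ _ (fun j => [set i; j])); last first.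
  move=> j k; rewrite !inE => /andP[ji _] _ jk.
  have : j \in [set i; k] by rewrite -jk !inE eqxx orbT.
  by rewrite !inE (negPf ji) => /eqP.
apply: eq_card => m; rewrite inE; apply/imsetP/andP => [[j]|[mD im]].
  by rewrite inE => /andP[_ ijD] ->; rewrite ijD !inE eqxx.
have /eqP/cards2P[j [k [jk mE]]] := D2 m mD.
move: mD im; rewrite mE !inE => mD /orP[]/eqP ->.
  by exists k => //; rewrite inE mD eq_sym jk.
by exists j; rewrite ?inE setUC ?mD ?jk.
Qed.

Lemma avg_strength2 i j : i != j ->
  avg_strength s [set i; j] = (((s i)%:R + (s j)%:R) / 2%:R)%R.
Proof.
by move=> ij; rewrite /avg_strength cards2 ij big_setU1 ?inE // big_set1.
Qed.

(* Every team occurs in exactly two opponent sets, so the common strength of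
   the opponent sets can only be the mean strength. *)
Lemma fair_avg_strength D i : is_draw 2 D -> fair s D ->
  avg_strength s (opponents D i) = mean_strength s.
Proof.
case=> D2 Dk Df; have N2 j : #|opponents D j| = 2 by rewrite card_opponents.
set c := avg_strength s _.
have cE j : (\sum_(k in opponents D j) (s k)%:R = c * 2%:R :> rat)%R.
  by rewrite /c (Df i j) /avg_strength N2 divfK.
have sumE : (\sum_j \sum_(k in opponents D j) (s k)%:R =
             (\sum_k (s k)%:R) * 2%:R :> rat)%R.
  under eq_bigr do rewrite big_mkcond.
  rewrite exchange_big mulr_suml; apply: eq_bigr => k _ /=.
  rewrite -big_mkcond sumr_const -(N2 k) mulr_natr; congr (_ *+ _)%R.
  by apply: eq_card => j; rewrite -[LHS]/(k \in opponents D j) !inE eq_sym setUC.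
have n0 : (#|T|%:R != 0 :> rat)%R.
  by rewrite pnatr_eq0 -lt0n; apply/card_gt0P; exists i.
have {}sumE : (c * #|T|%:R = \sum_k (s k)%:R :> rat)%R.
  apply: (@mulIf _ 2%:R%R) => //; rewrite -sumE (eq_bigr _ (fun j _ => cE j)).
  by rewrite sumr_const -[RHS]mulr_natr mulrAC.
rewrite /mean_strength /avg_strength cardsT.
under eq_bigl do rewrite inE.
by rewrite -sumE mulfK.
Qed.

Lemma draw_schedule D : is_draw 2 D -> fair s D -> respects R B D ->
  schedule v R B [rel i j | j \in opponents D i].
Proof.
move=> Dd Df Dr; have [D2 Dk] := Dd; split=> [i j|i j|i _].
- by rewrite /= !inE eq_sym setUC.
- rewrite /= inE => /andP[_ /Dr]; rewrite !subUset !sub1set !(in_blue RB RBT).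
  by case: (i \in R); case: (j \in R).
have /eqP/cards2P[j [k [jk NE]]] : #|opponents D i| = 2 by rewrite card_opponents.
exists j, k; split; last by apply/setP => l; rewrite -NE inE.
have := fair_avg_strength i Dd Df; rewrite NE avg_strength2 // => h.
by rewrite -opponent_graphE /opponent_graph /= jk h eqxx.
Qed.

Lemma schedule_draw d : schedule v R B d ->
  exists D, [/\ is_draw 2 D, fair s D & respects R B D].
Proof.
case=> dC dRB dE; pose D := [set [set p.1; p.2] | p in [set p | d p.1 p.2]].
have dD i j : ([set i; j] \in D) = d i j.
  apply/imsetP/idP => [[[k l]]|dij]; last by exists (i, j); rewrite ?inE.
  rewrite inE /= => dkl /setP E.
  have kl : k != l.
    apply/eqP => kl; have := dRB _ _ dkl.
    by rewrite kl !(in_blue RB RBT); case: (_ \in R).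
  have := E i; have := E j; have := E k; have := E l; rewrite !inE !eqxx /= ?orbT.
  (* Either [(i, j)] is [(k, l)] or [(l, k)], or [i = j], which would leave [k] or [l] out of the
     pair. *)
  move=> lij kij /esym/orP[]/eqP jE /esym/orP[]/eqP iE; subst i j => //.
  - by move: lij; rewrite orbb eq_sym (negPf kl).
  - by rewrite dC.
  - by move: kij; rewrite orbb (negPf kl).
have dneq i j : d i j -> j != i.
  move=> dij; apply/eqP => ji; have := dRB _ _ dij.
  by rewrite ji !(in_blue RB RBT); case: (_ \in R).
have oppE i : opponents D i = [set j | d i j].
  apply/setP => j; rewrite !inE dD; case dij: (d i j); last by rewrite andbF.
  by rewrite (dneq _ _ dij).
have NE i : exists j k, opposed v j k /\ opponents D i = [set j; k].
  by have [|j [k [jk E]]] := dE i; [rewrite RBT inE | exists j, k; rewrite oppE].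
have D2 m : m \in D -> #|m| = 2.
  case/imsetP => -[i j]; rewrite inE /= => /dneq ij ->.
  by rewrite cards2 eq_sym ij.
have Df i : avg_strength s (opponents D i) = mean_strength s.
  have [j [k [jk ->]]] := NE i; rewrite avg_strength2; last by case/andP: jk.
  by move: jk; rewrite -opponent_graphE => /andP[_ /eqP].
exists D; split; first split=> // i.
- have [j [k [/andP[jk _] E]]] := NE i.
  by rewrite -card_opponents // E cards2 jk.
- by move=> i j; rewrite !Df.
move=> m /imsetP[[i j]]; rewrite inE /= => /dRB ij ->.
by move: ij; rewrite !subUset !sub1set !(in_blue RB RBT); case: (i \in R); case: (j \in R).
Qed.

End Draws.

Theorem theorem8 (T : finType) (s : T -> nat) (R B : {set T})
    (hn : (2 <= #|T| - 1)%N)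
    (hR : R <> set0) (hB : B <> set0)
    (hdisj : R :&: B = set0) (hcover : R :|: B = [set: T]) :
  (exists D : {set {set T}},
     is_draw 2 D /\ fair s D /\ respects R B D)
  <->
  (k_color s R B R = k_color s R B B /\
   forall C : {set T},
     C \in bipartite_components (colored_opponent_graph s R B) ->
     exists M : {set {set T}},
       perfect_matching (colored_opponent_graph s R B) C M).
Proof.
have RB : [disjoint R & B] by rewrite -setI_eq0 hdisj.
have BR : [disjoint B & R] by rewrite disjoint_sym.
rewrite !k_colorE //; split=> [[D [Dd [Df Dr]]]|[RB_card HM]].
  have dP := draw_schedule RB hcover Dd Df Dr.
  split=> [|C CP]; first exact: schedule_card RB dP.
  have /imsetP[i _ CE] : C \in components (colored_opponent_graph s R B).
    by move: CP; rewrite inE => /andP[].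
  (* A component has a single color, that of its representative [i]. *)
  rewrite CE in CP *; have [iR|iR] := boolP (i \in R).
    apply: (balanced_matched RB hcover (A := R)) => //; first by left.
    exact: schedule_balanced RB dP.
  apply: (balanced_matched RB hcover (A := B)) => //; first by right.
    exact: schedule_balanced BR (schedule_sym dP).
  by rewrite (in_blue RB hcover).
have [||d dP] := balanced_schedule (v := deviation s) RB RB_card.
- by apply: (matched_balanced RB hcover) => //; left.
- by apply: (matched_balanced RB hcover) => //; right.
by have [D []] := schedule_draw RB hcover dP; exists D.
Qed.
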